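(* In a type theory with propositional truncations, weak excluded middle holds if and only if there exist a function $f:\prod_{X:\mathcal{U}}X\to\mathbf{2}$ that is invariant under equivalence, types $X,Y:\mathcal{U}$ and points $x:X$, $y:Y$ such that $f_X(x)\neq f_Y(y)$ and such that the identity types $x=x$ and $y=y$ are propositions.
   Context: Work in intensional Martin-Löf type theory with $\Pi$-, $\Sigma$-, identity, finite types and natural numbers, and a universe $\mathcal{U}$ closed under these, extended with propositional truncations (for each type $A$ a proposition $\|A\|$ with a map $A\to\|A\|$, universal among maps from $A$ into propositions). $=$ is the identity type, $\neg A$ is $A\to\mathbf{0}$, $a\neq b$ is $\neg(a=b)$, $f_X$ abbreviates $f(X)$. A type is a proposition if any two of its elements are equal. Weak excluded middle: for all $A:\mathcal{U}$, $\neg A+\neg\neg A$. An equivalence is a map with a left and a right inverse. $f$ is invariant under equivalence if $f_Y(e(x))=f_X(x)$ for all $X,Y:\mathcal{U}$, equivalences $e:X\to Y$ and $x:X$. *)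

(* Defs.v *)
(* Intensional Martin-Löf type theory with Pi, Sigma, identity types, finite
   types, natural numbers, a universe and propositional truncations, as a formal
   system: raw terms, conversion and derivability.  The system is kept apart from
   Rocq's own [Type], where admissible classical axioms would decide every
   proposition and so settle weak excluded middle from the outside. *)
From Stdlib Require Import List.
Import ListNotations.

(** * Raw syntax: de Bruijn indices, abstract binding trees *)

(* [Univ small] is the universe U.  [Univ large] is not a type but a sort:
   "A : Univ large" is the judgment "A is a type". *)
Inductive level := small | large.

Inductive former :=
| fUniv (l : level)
| fPi | fLam | fApp
| fSig | fPair | fSplit
| fId | fRefl | fJ
| fEmpty | fEmptyElim
| fUnit | fStar | fUnitElim
| fBool | fFalse | fTrue | fBoolElim
| fNat | fZero | fSucc | fNatElim
| fTrunc | fTrIn | fTrSquash | fTrElim.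

(* An argument [(k, t)] binds the variables 0, ..., k - 1 of [t]. *)
Inductive tm :=
| Var (n : nat)
| Op (c : former) (args : list (nat * tm)).

Notation tUniv l := (Op (fUniv l) []).
Notation tU := (tUniv small).
Notation tPi A B := (Op fPi [(0, A); (1, B)]).
Notation tLam A b := (Op fLam [(0, A); (1, b)]).
Notation tApp f a := (Op fApp [(0, f); (0, a)]).
Notation tSig A B := (Op fSig [(0, A); (1, B)]).
Notation tPair A B a b := (Op fPair [(0, A); (1, B); (0, a); (0, b)]).
Notation tSplit A B C d p :=
  (Op fSplit [(0, A); (1, B); (1, C); (2, d); (0, p)]).
Notation tId A a b := (Op fId [(0, A); (0, a); (0, b)]).
Notation tRefl A a := (Op fRefl [(0, A); (0, a)]).
Notation tJ A a C d b p :=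
  (Op fJ [(0, A); (0, a); (2, C); (0, d); (0, b); (0, p)]).
Notation tEmpty := (Op fEmpty []).
Notation tEmptyElim C e := (Op fEmptyElim [(1, C); (0, e)]).
Notation tUnit := (Op fUnit []).
Notation tStar := (Op fStar []).
Notation tUnitElim C d u := (Op fUnitElim [(1, C); (0, d); (0, u)]).
Notation tBool := (Op fBool []).
Notation tFalse := (Op fFalse []).
Notation tTrue := (Op fTrue []).
Notation tBoolElim C d0 d1 b :=
  (Op fBoolElim [(1, C); (0, d0); (0, d1); (0, b)]).
Notation tNat := (Op fNat []).
Notation tZero := (Op fZero []).
Notation tSucc n := (Op fSucc [(0, n)]).
Notation tNatElim C z s n := (Op fNatElim [(1, C); (0, z); (2, s); (0, n)]).
Notation tTrunc A := (Op fTrunc [(0, A)]).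
Notation tTrIn A a := (Op fTrIn [(0, A); (0, a)]).
Notation tTrSquash A t u := (Op fTrSquash [(0, A); (0, t); (0, u)]).
Notation tTrElim A B h g t :=
  (Op fTrElim [(0, A); (0, B); (0, h); (0, g); (0, t)]).

(** * Renaming and substitution *)

Definition up_ren (r : nat -> nat) (n : nat) : nat :=
  match n with 0 => 0 | S m => S (r m) end.

Fixpoint ren (r : nat -> nat) (t : tm) : tm :=
  match t with
  | Var n => Var (r n)
  | Op c args =>
      Op c (map (fun '(k, u) => (k, ren (Nat.iter k up_ren r) u)) args)
  end.

Definition lift (k : nat) : tm -> tm := ren (Nat.add k).

Definition scons (t : tm) (s : nat -> tm) (n : nat) : tm :=
  match n with 0 => t | S m => s m end.

Definition up (s : nat -> tm) : nat -> tm := scons (Var 0) (fun n => lift 1 (s n)).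

Fixpoint subst (s : nat -> tm) (t : tm) : tm :=
  match t with
  | Var n => s n
  | Op c args =>
      Op c (map (fun '(k, u) => (k, subst (Nat.iter k up s) u)) args)
  end.

Definition inst (t a : tm) : tm := subst (scons a Var) t.
(* [a] replaces variable 1, [b] variable 0. *)
Definition inst2 (t a b : tm) : tm := subst (scons b (scons a Var)) t.

(** * Conversion: the congruence generated by the computation rules (no eta) *)

Inductive conv : tm -> tm -> Prop :=
| conv_refl t : conv t t
| conv_sym t u : conv t u -> conv u t
| conv_trans t u v : conv t u -> conv u v -> conv t v
| conv_cong c l k t u r :
    conv t u -> conv (Op c (l ++ (k, t) :: r)) (Op c (l ++ (k, u) :: r))
| conv_Pi A b a : conv (tApp (tLam A b) a) (inst b a)
| conv_Sig A B C d A' B' a b :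
    conv (tSplit A B C d (tPair A' B' a b)) (inst2 d a b)
| conv_Id A a C d b A' a' : conv (tJ A a C d b (tRefl A' a')) d
| conv_Unit C d : conv (tUnitElim C d tStar) d
| conv_False C d0 d1 : conv (tBoolElim C d0 d1 tFalse) d0
| conv_True C d0 d1 : conv (tBoolElim C d0 d1 tTrue) d1
| conv_Zero C z s : conv (tNatElim C z s tZero) z
| conv_Succ C z s n :
    conv (tNatElim C z s (tSucc n)) (inst2 s n (tNatElim C z s n)).

(** * Derivability *)

Definition tArr (A B : tm) : tm := tPi A (lift 1 B).

Definition tIsProp (A : tm) : tm :=
  tPi A (tPi (lift 1 A) (tId (lift 2 A) (Var 1) (Var 0))).

Reserved Notation "G |-- t : T" (at level 70, t at level 69, T at level 69).

(* The most recent hypothesis is at the head of the context. *)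
Inductive wf : list tm -> Prop :=
| wf_nil : wf []
| wf_cons G A l : G |-- A : tUniv l -> wf (A :: G)

with typing : list tm -> tm -> tm -> Prop :=
| ty_Var G n A : wf G -> nth_error G n = Some A -> G |-- Var n : lift (S n) A
| ty_Conv G t A B l :
    G |-- t : A -> conv A B -> G |-- B : tUniv l -> G |-- t : B

| ty_U G : wf G -> G |-- tU : tUniv large
| ty_El G A : G |-- A : tU -> G |-- A : tUniv large

| ty_Pi G A B l :
    G |-- A : tUniv l -> A :: G |-- B : tUniv l -> G |-- tPi A B : tUniv l
| ty_Lam G A B b l :
    G |-- tPi A B : tUniv l -> A :: G |-- b : B -> G |-- tLam A b : tPi A B
| ty_App G A B f a :
    G |-- f : tPi A B -> G |-- a : A -> G |-- tApp f a : inst B a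

| ty_Sig G A B l :
    G |-- A : tUniv l -> A :: G |-- B : tUniv l -> G |-- tSig A B : tUniv l
| ty_Pair G A B a b l :
    G |-- tSig A B : tUniv l -> G |-- a : A -> G |-- b : inst B a ->
    G |-- tPair A B a b : tSig A B
| ty_Split G A B C d p l :
    tSig A B :: G |-- C : tUniv l ->
    B :: A :: G |-- d :
      subst (scons (tPair (lift 2 A) (ren (up_ren (Nat.add 2)) B) (Var 1) (Var 0))
                   (fun n => Var (2 + n))) C ->
    G |-- p : tSig A B ->
    G |-- tSplit A B C d p : inst C p

| ty_Id G A a b l :
    G |-- A : tUniv l -> G |-- a : A -> G |-- b : A -> G |-- tId A a b : tUniv l
| ty_Refl G A a l :
    G |-- A : tUniv l -> G |-- a : A -> G |-- tRefl A a : tId A a a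
| ty_J G A a C d b p l :
    tId (lift 1 A) (lift 1 a) (Var 0) :: A :: G |-- C : tUniv l ->
    G |-- d : inst2 C a (tRefl A a) ->
    G |-- b : A -> G |-- p : tId A a b ->
    G |-- tJ A a C d b p : inst2 C b p

| ty_Empty G : wf G -> G |-- tEmpty : tU
| ty_EmptyElim G C e l :
    tEmpty :: G |-- C : tUniv l -> G |-- e : tEmpty ->
    G |-- tEmptyElim C e : inst C e

| ty_Unit G : wf G -> G |-- tUnit : tU
| ty_Star G : wf G -> G |-- tStar : tUnit
| ty_UnitElim G C d u l :
    tUnit :: G |-- C : tUniv l -> G |-- d : inst C tStar -> G |-- u : tUnit ->
    G |-- tUnitElim C d u : inst C u

| ty_Bool G : wf G -> G |-- tBool : tU
| ty_False G : wf G -> G |-- tFalse : tBool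
| ty_True G : wf G -> G |-- tTrue : tBool
| ty_BoolElim G C d0 d1 b l :
    tBool :: G |-- C : tUniv l ->
    G |-- d0 : inst C tFalse -> G |-- d1 : inst C tTrue -> G |-- b : tBool ->
    G |-- tBoolElim C d0 d1 b : inst C b

| ty_Nat G : wf G -> G |-- tNat : tU
| ty_Zero G : wf G -> G |-- tZero : tNat
| ty_Succ G n : G |-- n : tNat -> G |-- tSucc n : tNat
| ty_NatElim G C z s n l :
    tNat :: G |-- C : tUniv l ->
    G |-- z : inst C tZero ->
    C :: tNat :: G |-- s :
      subst (scons (tSucc (Var 1)) (fun n => Var (2 + n))) C ->
    G |-- n : tNat ->
    G |-- tNatElim C z s n : inst C n

(* No computation rule for [tTrElim]: since the target is a proposition, the
   factorization through [tTrIn] holds up to the identity type anyway. *)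
| ty_Trunc G A l : G |-- A : tUniv l -> G |-- tTrunc A : tUniv l
| ty_TrIn G A a l :
    G |-- A : tUniv l -> G |-- a : A -> G |-- tTrIn A a : tTrunc A
| ty_TrSquash G A t u l :
    G |-- A : tUniv l -> G |-- t : tTrunc A -> G |-- u : tTrunc A ->
    G |-- tTrSquash A t u : tId (tTrunc A) t u
| ty_TrElim G A B h g t l m :
    G |-- A : tUniv l -> G |-- B : tUniv m ->
    G |-- h : tIsProp B -> G |-- g : tArr A B -> G |-- t : tTrunc A ->
    G |-- tTrElim A B h g t : B

where "G |-- t : T" := (typing G t T).

(** * Internal notions *)

Definition tProd (A B : tm) : tm := tSig A (lift 1 B).

Definition tIff (A B : tm) : tm := tProd (tArr A B) (tArr B A).

Definition tNeg (A : tm) : tm := tArr A tEmpty.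

(* Binary coproducts of small types, from the type 2:
   A + B is the sum over b : 2 of (if b is false then A else B). *)
Definition tSum (A B : tm) : tm :=
  tSig tBool (tBoolElim tU (lift 1 A) (lift 1 B) (Var 0)).

(* Pi (A : U), ~ A + ~ ~ A *)
Definition tWEM : tm := tPi tU (tSum (tNeg (Var 0)) (tNeg (tNeg (Var 0)))).

(* (Sigma (g : Y -> X), Pi (x : X), g (e x) = x) *
   (Sigma (h : Y -> X), Pi (y : Y), e (h y) = y) *)
Definition tIsEquiv (X Y e : tm) : tm :=
  tProd
    (tSig (tArr Y X)
       (tPi (lift 1 X)
          (tId (lift 2 X) (tApp (Var 1) (tApp (lift 2 e) (Var 0))) (Var 0))))
    (tSig (tArr Y X)
       (tPi (lift 1 Y)
          (tId (lift 2 Y) (tApp (lift 2 e) (tApp (Var 1) (Var 0))) (Var 0)))).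

(* Pi (X : U), X -> 2 *)
Definition tBoolFamily : tm := tPi tU (tArr (Var 0) tBool).

(* Pi (X Y : U) (e : X -> Y), IsEquiv e -> Pi (x : X), f Y (e x) = f X x *)
Definition tInvariant (f : tm) : tm :=
  tPi tU (tPi tU
    (tPi (tArr (Var 1) (Var 0))
      (tPi (tIsEquiv (Var 2) (Var 1) (Var 0))
        (tPi (Var 3)
          (tId tBool
             (tApp (tApp (lift 5 f) (Var 3)) (tApp (Var 2) (Var 0)))
             (tApp (tApp (lift 5 f) (Var 4)) (Var 0))))))).

(* Sigma (f : Pi (X : U), X -> 2), Invariant f *
     Sigma (X Y : U) (x : X) (y : Y),
       ~ (f X x = f Y y) * (IsProp (x = x) * IsProp (y = y)) *)
Definition tSeparatingInvariantFamily : tm :=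
  tSig tBoolFamily
    (tProd (tInvariant (Var 0))
      (tSig tU (tSig tU (tSig (Var 1) (tSig (Var 1)
        (tProd
          (tNeg (tId tBool (tApp (tApp (Var 4) (Var 3)) (Var 1))
                           (tApp (tApp (Var 4) (Var 2)) (Var 0))))
          (tProd (tIsProp (tId (Var 3) (Var 1) (Var 1)))
                 (tIsProp (tId (Var 2) (Var 0) (Var 0)))))))))).

(* Main.v *)
(* From WEM: decide the type "x is a centre of contraction of X", that is
   [Pi (y : X), x = y]; which of the two sides holds is invariant under
   equivalence, and it separates the point of 1 from a point of 2.

   To WEM: for a type A glue the two pointed types into
     Z = Sigma (u : X) (v : Y), || (~~A -> x = u) * (~A -> y = v) ||,
   pointed by (x, y).  As x = x is a proposition so is each x = u, and likewise
   for y, so these paths can be extracted from the truncation.  Hence Z is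
   equivalent to (X, x) if ~A and to (Y, y) if ~~A, and comparing the booleans
   f_Z (x, y) and f_X x decides ~A.  Phrasing Z with Sigma-types avoids function
   extensionality.

   The derivation is found by a type inference function proved sound for the
   formal system.  Inference re-checks every type that it converts to, so that
   neither substitution lemmas nor subject reduction are needed. *)
Require Import Defs.
From Stdlib Require Import List Arith.
Import ListNotations.

(** * Syntactic equality and normalisation *)

Definition former_eq_dec (c d : former) : {c = d} + {c <> d}.
Proof. decide equality; decide equality. Defined.

Fixpoint tm_eq_dec (t u : tm) : {t = u} + {t <> u}.
Proof.
  destruct t as [n | c l], u as [m | d r]; try (right; discriminate).
  - destruct (Nat.eq_dec n m) as [-> | ne]; [now left | right; congruence].
  - destruct (former_eq_dec c d) as [-> | ne]; [| right; congruence].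
    assert (eq_arg : forall a b : nat * tm, {a = b} + {a <> b}).
    { intros [i a] [j b]. destruct (Nat.eq_dec i j) as [-> | ne]; [| right; congruence].
      destruct (tm_eq_dec a b) as [-> | ne]; [now left | right; congruence]. }
    destruct (list_eq_dec eq_arg l r) as [-> | ne]; [now left | right; congruence].
Defined.

Definition head_step (t : tm) : option tm :=
  match t with
  | tApp (tLam _ b) a => Some (inst b a)
  | tSplit _ _ _ d (tPair _ _ a b) => Some (inst2 d a b)
  | tJ _ _ _ d _ (tRefl _ _) => Some d
  | tUnitElim _ d tStar => Some d
  | tBoolElim _ d0 _ tFalse => Some d0
  | tBoolElim _ _ d1 tTrue => Some d1
  | tNatElim _ z _ tZero => Some z
  | tNatElim C z s (tSucc n) => Some (inst2 s n (tNatElim C z s n))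
  | _ => None
  end.

(** When the fuel [n] runs out the term is left as it is. The result is convertible to [t] whether
    or not it is normal, so neither termination nor confluence has to be proved. *)
Fixpoint nf (n : nat) (t : tm) : tm :=
  match n, t with
  | S n, Op c args =>
      let t' := Op c (map (fun '(k, u) => (k, nf n u)) args) in
      match head_step t' with Some u => nf n u | None => t' end
  | _, _ => t
  end.

Ltac destruct_matches H :=
  repeat (match type of H with context [match ?x with _ => _ end] =>
            is_var x; destruct x end; try discriminate H).

Lemma head_step_sound t u : head_step t = Some u -> conv t u.
Proof.
  unfold head_step. intros H. destruct_matches H; injection H as <-;
    auto using conv_Pi, conv_Sig, conv_Id, conv_Unit, conv_False, conv_True, conv_Zero, conv_Succ.
Qed.

(** [conv_cong] rewrites one argument at a time; [pre] collects those already rewritten. *)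
Lemma conv_map F c args : (forall t, conv t (F t)) -> forall pre,
  conv (Op c (pre ++ args)) (Op c (pre ++ map (fun '(k, u) => (k, F u)) args)).
Proof.
  intros HF. induction args as [| [k u] args IH]; intros pre; [constructor |].
  apply conv_trans with (Op c (pre ++ (k, F u) :: args)).
  - now apply conv_cong.
  - specialize (IH (pre ++ [(k, F u)])). now rewrite <- !app_assoc in IH.
Qed.

Lemma conv_nf n t : conv t (nf n t).
Proof.
  revert t. induction n as [| n IH]; intros [m | c args]; try apply conv_refl.
  cbn [nf]. pose proof (conv_map (nf n) c args IH []) as H. cbn [app] in H.
  destruct (head_step _) eqn:E; [| exact H].
  eapply conv_trans; [exact H |].
  eapply conv_trans; [exact (head_step_sound _ _ E) | apply IH].
Qed.

(** * Type inference and its soundness *)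

Definition level_max (l m : level) : level :=
  match l with small => m | large => large end.

Notation "'do' x <- e ; k" := (match e with Some x => k | None => None end)
  (at level 200, x name, e at level 100, k at level 200).
Notation "'guard' e ; k" := (if e then k else None)
  (at level 200, e at level 100, k at level 200).

Section Checker.

Variable fuel : nat.
Variable infer : list tm -> tm -> option tm.

(** A sort found literally is accepted at either level. After normalisation only [tU] is accepted:
    [ty_Conv] demands that the new type be typed, and [ty_U] provides this for [tU]. *)
Definition infer_sort (G : list tm) (A : tm) : option level :=
  do T <- infer G A;
  match T with
  | tUniv l => Some l
  | _ => if tm_eq_dec (nf fuel T) tU then Some small else None
  end.

Definition check (G : list tm) (t A : tm) : bool :=
  match infer G t with
  | Some T =>
      if tm_eq_dec T A then true
      else match infer_sort G A with
           | Some _ => if tm_eq_dec (nf fuel T) (nf fuel A) then true else false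
           | None => false
           end
  | None => false
  end.

Definition infer_pi (G : list tm) (t : tm) : option (tm * tm) :=
  match infer G t with
  | Some (tPi A B) => Some (A, B)
  | Some T =>
      match nf fuel T with
      | tPi A B => do l <- infer_sort G (tPi A B); Some (A, B)
      | _ => None
      end
  | None => None
  end.

Definition infer_step (G : list tm) (t : tm) : option tm :=
  match t with
  | Var n => do A <- nth_error G n; Some (lift (S n) A)
  | tUniv small => Some (tUniv large)
  | tPi A B | tSig A B =>
      do l <- infer_sort G A;
      do m <- infer_sort (A :: G) B;
      Some (tUniv (level_max l m))
  | tLam A b =>
      do l <- infer_sort G A;
      do B <- infer (A :: G) b;
      do m <- infer_sort (A :: G) B;
      Some (tPi A B)
  | tApp f a =>
      do AB <- infer_pi G f;
      guard check G a (fst AB);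
      Some (inst (snd AB) a)
  | tPair A B a b =>
      do l <- infer_sort G (tSig A B);
      guard check G a A;
      guard check G b (inst B a);
      Some (tSig A B)
  | tSplit A B C d p =>
      (* The sorts of the sum, of [A] and of [B] make the extended contexts well formed, as
         soundness of the calls made in them requires. *)
      do i <- infer_sort G (tSig A B);
      do l <- infer_sort (tSig A B :: G) C;
      do j <- infer_sort G A;
      do k <- infer_sort (A :: G) B;
      guard check (B :: A :: G) d
        (subst (scons (tPair (lift 2 A) (ren (up_ren (Nat.add 2)) B) (Var 1) (Var 0))
                   (fun n => Var (2 + n))) C);
      guard check G p (tSig A B);
      Some (inst C p)
  | tId A a b =>
      do l <- infer_sort G A;
      guard check G a A;
      guard check G b A;
      Some (tUniv l)
  | tRefl A a =>
      do l <- infer_sort G A;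
      guard check G a A;
      Some (tId A a a)
  | tJ A a C d b p =>
      do i <- infer_sort G A;
      do j <- infer_sort (A :: G) (tId (lift 1 A) (lift 1 a) (Var 0));
      do l <- infer_sort (tId (lift 1 A) (lift 1 a) (Var 0) :: A :: G) C;
      guard check G d (inst2 C a (tRefl A a));
      guard check G b A;
      guard check G p (tId A a b);
      Some (inst2 C b p)
  | tEmpty => Some tU
  | tEmptyElim C e =>
      do l <- infer_sort (tEmpty :: G) C;
      guard check G e tEmpty;
      Some (inst C e)
  | tUnit => Some tU
  | tStar => Some tUnit
  | tUnitElim C d u =>
      do l <- infer_sort (tUnit :: G) C;
      guard check G d (inst C tStar);
      guard check G u tUnit;
      Some (inst C u)
  | tBool => Some tU
  | tFalse => Some tBool
  | tTrue => Some tBool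
  | tBoolElim C d0 d1 b =>
      do l <- infer_sort (tBool :: G) C;
      guard check G d0 (inst C tFalse);
      guard check G d1 (inst C tTrue);
      guard check G b tBool;
      Some (inst C b)
  | tTrunc A =>
      do l <- infer_sort G A;
      Some (tUniv l)
  | tTrIn A a =>
      do l <- infer_sort G A;
      guard check G a A;
      Some (tTrunc A)
  | tTrSquash A t u =>
      do l <- infer_sort G A;
      guard check G t (tTrunc A);
      guard check G u (tTrunc A);
      Some (tId (tTrunc A) t u)
  | tTrElim A B h g t =>
      do l <- infer_sort G A;
      do m <- infer_sort G B;
      guard check G h (tIsProp B);
      guard check G g (tArr A B);
      guard check G t (tTrunc A);
      Some B
  | _ => None
  end.

(** Soundness of the recursive calls, discharged below by induction on the fuel. *)
Hypothesis infer_sound :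
  forall G t T, wf G -> infer G t = Some T -> G |-- t : T.

Lemma infer_sort_sound G A l : wf G -> infer_sort G A = Some l -> G |-- A : tUniv l.
Proof.
  unfold infer_sort. intros HG H. destruct (infer G A) as [T |] eqn:E; [| discriminate].
  apply infer_sound in E; [| exact HG].
  assert (slow : (if tm_eq_dec (nf fuel T) tU then Some small else None) = Some l ->
                 G |-- A : tUniv l).
  { destruct (tm_eq_dec _ _) as [e |]; [| discriminate]. intros [= <-].
    eapply ty_Conv; [exact E | | exact (ty_U G HG)]. rewrite <- e. apply conv_nf. }
  destruct T as [| [] []]; try exact (slow H). now injection H as <-.
Qed.

Lemma conv_by_nf t u : nf fuel t = nf fuel u -> conv t u.
Proof.
  intros e. apply conv_trans with (nf fuel t); [apply conv_nf |].
  rewrite e. apply conv_sym, conv_nf.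
Qed.

Lemma check_sound G t A : wf G -> check G t A = true -> G |-- t : A.
Proof.
  unfold check. intros HG H. destruct (infer G t) as [T |] eqn:E; [| discriminate].
  apply infer_sound in E; [| exact HG].
  destruct (tm_eq_dec T A) as [<- |]; [exact E |].
  destruct (infer_sort G A) as [l |] eqn:EA; [| discriminate].
  destruct (tm_eq_dec _ _) as [e |]; [| discriminate].
  eapply ty_Conv; [exact E | exact (conv_by_nf _ _ e) | exact (infer_sort_sound _ _ _ HG EA)].
Qed.

Lemma infer_pi_sound G t A B :
  wf G -> infer_pi G t = Some (A, B) -> G |-- t : tPi A B.
Proof.
  unfold infer_pi. intros HG H. destruct (infer G t) as [T |] eqn:E; [| discriminate].
  apply infer_sound in E; [| exact HG].
  assert (slow : match nf fuel T with
                 | tPi A B => do l <- infer_sort G (tPi A B); Some (A, B)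
                 | _ => None
                 end = Some (A, B) -> G |-- t : tPi A B).
  { clear H. intros H. destruct (nf fuel T) eqn:e; [discriminate |].
    destruct_matches H.
    destruct (infer_sort _ _) as [l |] eqn:s in H; [| discriminate]. injection H as -> ->.
    eapply ty_Conv; [exact E | rewrite <- e; apply conv_nf | exact (infer_sort_sound _ _ _ HG s)]. }
  destruct T as [| c args]; [exact (slow H) |].
  repeat match type of H with context [match ?x with _ => _ end] =>
    is_var x; destruct x; try exact (slow H) end.
  now injection H as -> ->.
Qed.

Lemma ty_cumul G A l m : G |-- A : tUniv l -> G |-- A : tUniv (level_max l m).
Proof. destruct l, m; cbn; auto using ty_El. Qed.

Lemma ty_cumul_r G A l m : G |-- A : tUniv l -> G |-- A : tUniv (level_max m l).
Proof. destruct l, m; cbn; auto using ty_El. Qed.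

Lemma ty_Pi_max G A B l m :
  G |-- A : tUniv l -> A :: G |-- B : tUniv m ->
  G |-- tPi A B : tUniv (level_max l m).
Proof. intros HA HB. apply ty_Pi; [now apply ty_cumul | now apply ty_cumul_r]. Qed.

Lemma ty_Sig_max G A B l m :
  G |-- A : tUniv l -> A :: G |-- B : tUniv m ->
  G |-- tSig A B : tUniv (level_max l m).
Proof. intros HA HB. apply ty_Sig; [now apply ty_cumul | now apply ty_cumul_r]. Qed.

Lemma infer_step_sound G t T : wf G -> infer_step G t = Some T -> G |-- t : T.
Proof.
  intros HG H. unfold infer_step in H.
  destruct_matches H;
  repeat match type of H with
  | (if check ?G ?t ?A then _ else _) = _ =>
      let E := fresh "E" in destruct (check G t A) eqn:E in H; [| discriminate H];
      apply check_sound in E; [| eauto using wf_cons]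
  | match ?x with _ => _ end = _ =>
      let E := fresh "E" in destruct x eqn:E in H; [| discriminate H];
      lazymatch type of E with
      | infer_sort _ _ = _ => apply infer_sort_sound in E; [| eauto using wf_cons]
      | infer _ _ = _ => apply infer_sound in E; [| eauto using wf_cons]
      | infer_pi _ _ = Some ?p =>
          destruct p; apply infer_pi_sound in E; [| eauto using wf_cons]
      | _ => idtac
      end
  end;
  try injection H as <-;
  solve [eauto using ty_Pi_max, ty_Sig_max, wf_cons, ty_Empty, ty_Unit, ty_Bool | econstructor; solve [eauto using ty_Pi_max]].
Qed.

End Checker.

Fixpoint infer (n : nat) : list tm -> tm -> option tm :=
  match n with
  | 0 => fun _ _ => None
  | S n => infer_step n (infer n)
  end.

Lemma infer_sound n G t T : wf G -> infer n G t = Some T -> G |-- t : T.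
Proof.
  revert G t T. induction n as [| n IH]; [discriminate |].
  intros G t T. now apply infer_step_sound.
Qed.

(** * Terms with named binders *)

(* A term as a function of the number of variables in scope.  A bound variable
   introduced at depth d is the de Bruijn level d, hence the index d' - S d when
   it is used at depth d'. *)
Definition hterm := nat -> tm.

Definition bind1 (B : hterm -> hterm) : hterm :=
  fun d => B (fun d' => Var (d' - S d)) (S d).

Definition bind2 (B : hterm -> hterm -> hterm) : hterm :=
  fun d => B (fun d' => Var (d' - S d)) (fun d' => Var (d' - S (S d))) (S (S d)).

Definition hU : hterm := fun _ => tU.
Definition hPi (A : hterm) (B : hterm -> hterm) : hterm := fun d => tPi (A d) (bind1 B d).
Definition hLam (A : hterm) (b : hterm -> hterm) : hterm := fun d => tLam (A d) (bind1 b d).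
Definition hApp (f a : hterm) : hterm := fun d => tApp (f d) (a d).
Definition hSig (A : hterm) (B : hterm -> hterm) : hterm := fun d => tSig (A d) (bind1 B d).
Definition hPair (A : hterm) (B : hterm -> hterm) (a b : hterm) : hterm :=
  fun d => tPair (A d) (bind1 B d) (a d) (b d).
Definition hSplit (A : hterm) (B C : hterm -> hterm) (c : hterm -> hterm -> hterm)
    (p : hterm) : hterm :=
  fun d => tSplit (A d) (bind1 B d) (bind1 C d) (bind2 c d) (p d).
Definition hId (A a b : hterm) : hterm := fun d => tId (A d) (a d) (b d).
Definition hRefl (A a : hterm) : hterm := fun d => tRefl (A d) (a d).
Definition hJ (A a : hterm) (C : hterm -> hterm -> hterm) (c b p : hterm) : hterm :=
  fun d => tJ (A d) (a d) (bind2 C d) (c d) (b d) (p d).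
Definition hEmpty : hterm := fun _ => tEmpty.
Definition hEmptyElim (C e : hterm) : hterm :=
  fun d => tEmptyElim (bind1 (fun _ => C) d) (e d).
Definition hUnit : hterm := fun _ => tUnit.
Definition hStar : hterm := fun _ => tStar.
Definition hUnitElim (C : hterm -> hterm) (c u : hterm) : hterm :=
  fun d => tUnitElim (bind1 C d) (c d) (u d).
Definition hBool : hterm := fun _ => tBool.
Definition hFalse : hterm := fun _ => tFalse.
Definition hTrue : hterm := fun _ => tTrue.
Definition hBoolElim (C : hterm -> hterm) (c0 c1 b : hterm) : hterm :=
  fun d => tBoolElim (bind1 C d) (c0 d) (c1 d) (b d).
Definition hTrunc (A : hterm) : hterm := fun d => tTrunc (A d).
Definition hTrIn (A a : hterm) : hterm := fun d => tTrIn (A d) (a d).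
Definition hTrSquash (A t u : hterm) : hterm := fun d => tTrSquash (A d) (t d) (u d).
Definition hTrElim (A B h g t : hterm) : hterm :=
  fun d => tTrElim (A d) (B d) (h d) (g d) (t d).

(** Reusing the de Bruijn definitions at each depth keeps the types those of the theorem; [lift]
    does the shifting under their binders. *)
Definition hArr (A B : hterm) : hterm := fun d => tArr (A d) (B d).
Definition hIsProp (A : hterm) : hterm := fun d => tIsProp (A d).
Definition hProd (A B : hterm) : hterm := fun d => tProd (A d) (B d).
Definition hNeg (A : hterm) : hterm := fun d => tNeg (A d).
Definition hSum (A B : hterm) : hterm := fun d => tSum (A d) (B d).
Definition hIsEquiv (X Y e : hterm) : hterm := fun d => tIsEquiv (X d) (Y d) (e d).
Definition hInvariant (f : hterm) : hterm := fun d => tInvariant (f d).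
Definition hWEM : hterm := fun _ => tWEM.
Definition hSep : hterm := fun _ => tSeparatingInvariantFamily.
Definition hBoolFamily : hterm := fun _ => tBoolFamily.

Declare Scope hterm_scope.
Bind Scope hterm_scope with hterm.
Delimit Scope hterm_scope with h.
Open Scope hterm_scope.

Notation "\ x : A , b" := (hLam A (fun x => b))
  (at level 200, x name, A at level 99, b at level 200) : hterm_scope.
Notation "'PI' x : A , B" := (hPi A (fun x => B))
  (at level 200, x name, A at level 99, B at level 200) : hterm_scope.
Notation "'SIG' x : A , B" := (hSig A (fun x => B))
  (at level 200, x name, A at level 99, B at level 200) : hterm_scope.
Notation "f @ a" := (hApp f a) (at level 11, left associativity) : hterm_scope.
Notation "A ~> B" := (hArr A B) (at level 60, right associativity) : hterm_scope.

(** * Projections, paths, booleans and coproducts *)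

Definition hFst (A : hterm) (B : hterm -> hterm) (p : hterm) : hterm :=
  hSplit A B (fun _ => A) (fun a _ => a) p.

Definition hSnd (A : hterm) (B : hterm -> hterm) (p : hterm) : hterm :=
  hSplit A B (fun p => B (hFst A B p)) (fun _ b => b) p.

Definition hPairND (A B a b : hterm) : hterm := hPair A (fun _ => B) a b.

Definition hSym (A a b p : hterm) : hterm :=
  hJ A a (fun b _ => hId A b a) (hRefl A a) b p.

Definition hTrans (A a b c p q : hterm) : hterm :=
  hJ A b (fun c _ => hId A a c) p c q.

Definition hAp (A B f a b p : hterm) : hterm :=
  hJ A a (fun b _ => hId B (f @ a) (f @ b)) (hRefl B (f @ a)) b p.

(** Transport of [hStar] in the family that is [hUnit] over true and [hEmpty] over false. *)
Definition hTrueNeFalse (p : hterm) : hterm :=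
  hJ hBool hTrue (fun b _ => hBoolElim (fun _ => hU) hEmpty hUnit b) hStar hFalse p.

(* [hSum A B] is a sum over [hBool]; [hBranch A B b] is its fibre over [b]. *)
Definition hBranch (A B b : hterm) : hterm := hBoolElim (fun _ => hU) A B b.

Definition hInl (A B a : hterm) : hterm := hPair hBool (hBranch A B) hFalse a.

Definition hInr (A B b : hterm) : hterm := hPair hBool (hBranch A B) hTrue b.

(** The boolean is eliminated into functions of [w], so that the type of [w] computes to [A] or to
    [B] in each branch. *)
Definition hCase (A B : hterm) (C : hterm -> hterm) (l r s : hterm) : hterm :=
  hSplit hBool (hBranch A B) C
    (fun b w =>
       hBoolElim (fun b => PI w : hBranch A B b, C (hPair hBool (hBranch A B) b w))
         l r b @ w)
    s.

(* The boolean telling which of ~A (false) and ~~A (true) was decided. *)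
Definition hSide (A s : hterm) : hterm :=
  hFst hBool (hBranch (hNeg A) (hNeg (hNeg A))) s.

Definition hSideTrue (A s h : hterm) : hterm :=
  hCase (hNeg A) (hNeg (hNeg A)) (fun s => hId hBool hTrue (hSide A s))
    (\n : hNeg A, hEmptyElim (hId hBool hTrue hFalse) (h @ n))
    (\_ : hNeg (hNeg A), hRefl hBool hTrue)
    s.

Definition hSideFalse (A s h : hterm) : hterm :=
  hCase (hNeg A) (hNeg (hNeg A)) (fun s => hId hBool hFalse (hSide A s))
    (\_ : hNeg A, hRefl hBool hFalse)
    (\n : hNeg (hNeg A), hEmptyElim (hId hBool hFalse hTrue) (n @ h))
    s.

(** The two sides exclude each other, so the side taken by any decision depends only on the type up
    to logical equivalence; [s] and [t] may be unrelated. *)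
Definition hSideIff (A B f g s t : hterm) : hterm :=
  hCase (hNeg A) (hNeg (hNeg A)) (fun s => hId hBool (hSide B t) (hSide A s))
    (\n : hNeg A,
       hSym hBool hFalse (hSide B t) (hSideFalse B t (\b : B, n @ (g @ b))))
    (\n : hNeg (hNeg A),
       hSym hBool hTrue (hSide B t)
         (hSideTrue B t (\m : hNeg B, n @ (\a : A, m @ (f @ a)))))
    s.

(** * From weak excluded middle to a separating family *)

Definition hCenter (X x : hterm) : hterm := PI y : X, hId X x y.

Definition hCenterFamily (w : hterm) : hterm :=
  \X : hU, \x : X, hSide (hCenter X x) (w @ hCenter X x).

(** Being a centre passes from [x] to [e @ x] by the right inverse [h], since each [y] equals
    [e @ (h @ y)], and back by the left inverse [g]. *)
Definition hCenterFamilyInvariant (w : hterm) : hterm :=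
  \X : hU, \Y : hU, \e : X ~> Y, \i : hIsEquiv X Y e, \x : X,
  let L := SIG g : Y ~> X, PI x : X, hId X (g @ (e @ x)) x in
  let R := SIG h : Y ~> X, PI y : Y, hId Y (e @ (h @ y)) y in
  let f := hCenterFamily w in
  let C := hId hBool (f @ Y @ (e @ x)) (f @ X @ x) in
  hSplit L (fun _ => R) (fun _ => C) (fun l r =>
    hSplit (Y ~> X) (fun g => PI x : X, hId X (g @ (e @ x)) x) (fun _ => C) (fun g gK =>
      hSplit (Y ~> X) (fun h => PI y : Y, hId Y (e @ (h @ y)) y) (fun _ => C) (fun h hK =>
        hSideIff (hCenter X x) (hCenter Y (e @ x))
          (\c : hCenter X x, \y : Y,
             hTrans Y (e @ x) (e @ (h @ y)) y
               (hAp X Y e x (h @ y) (c @ (h @ y))) (hK @ y))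
          (\c : hCenter Y (e @ x), \y : X,
             hTrans X x (g @ (e @ x)) y
               (hSym X (g @ (e @ x)) x (gK @ x))
               (hTrans X (g @ (e @ x)) (g @ (e @ y)) y
                  (hAp Y X g (e @ x) (e @ y) (c @ (e @ y))) (gK @ y)))
          (w @ hCenter X x) (w @ hCenter Y (e @ x)))
      r) l) i.

Definition hUnitCenter : hterm :=
  \u : hUnit, hUnitElim (fun u => hId hUnit hStar u) (hRefl hUnit hStar) u.

Definition hFalseNotCenter : hterm :=
  \c : hCenter hBool hFalse, hTrueNeFalse (hSym hBool hFalse hTrue (c @ hTrue)).

Definition hCenterFamilySeparates (w : hterm) : hterm :=
  let s := hSide (hCenter hUnit hStar) (w @ hCenter hUnit hStar) in
  let t := hSide (hCenter hBool hFalse) (w @ hCenter hBool hFalse) in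
  \p : hId hBool s t,
  hTrueNeFalse
    (hTrans hBool hTrue t hFalse
       (hTrans hBool hTrue s t
          (hSideTrue (hCenter hUnit hStar) (w @ hCenter hUnit hStar)
             (\n : hNeg (hCenter hUnit hStar), n @ hUnitCenter))
          p)
       (hSym hBool hFalse t
          (hSideFalse (hCenter hBool hFalse) (w @ hCenter hBool hFalse) hFalseNotCenter))).

Definition hLoopsProp (A a K : hterm) : hterm :=
  let P := hId A a a in
  \p : P, \q : P,
  hTrans P p (hRefl A a) q (K @ p) (hSym P q (hRefl A a) (K @ q)).

(** Path induction needs a free endpoint [u]; the loop is compared with [hUnitCenter @ u], which
    computes to reflexivity at [hStar]. *)
Definition hUnitLoopsProp : hterm :=
  hLoopsProp hUnit hStar
    (\p : hId hUnit hStar hStar,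
     hJ hUnit hStar (fun u p => hId (hId hUnit hStar u) p (hUnitCenter @ u))
       (hRefl (hId hUnit hStar hStar) (hRefl hUnit hStar)) hStar p).

(** Again the endpoint [b] is freed: the family claims [p] to be reflexivity over false and is
    [hUnit] over true, where that claim would not typecheck. *)
Definition hFalseLoopsProp : hterm :=
  hLoopsProp hBool hFalse
    (\p : hId hBool hFalse hFalse,
     hJ hBool hFalse
       (fun b p =>
          hBoolElim (fun b => hId hBool hFalse b ~> hU)
            (\p : hId hBool hFalse hFalse,
               hId (hId hBool hFalse hFalse) p (hRefl hBool hFalse))
            (\_ : hId hBool hFalse hTrue, hUnit) b @ p)
       (hRefl (hId hBool hFalse hFalse) (hRefl hBool hFalse)) hFalse p).

Definition hPointsData (f X Y x y : hterm) : hterm :=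
  hProd (hNeg (hId hBool (f @ X @ x) (f @ Y @ y)))
    (hProd (hIsProp (hId X x x)) (hIsProp (hId Y y y))).
Definition hTypesData (f X Y : hterm) : hterm := SIG x : X, SIG y : Y, hPointsData f X Y x y.
Definition hSeparation (f : hterm) : hterm := SIG X : hU, SIG Y : hU, hTypesData f X Y.
Definition hFamilyData (f : hterm) : hterm := hProd (hInvariant f) (hSeparation f).

Definition hSepOfWEM : hterm :=
  \w : hWEM,
  let f := hCenterFamily w in
  hPair hBoolFamily hFamilyData f
    (hPairND (hInvariant f) (hSeparation f) (hCenterFamilyInvariant w)
      (hPair hU (fun X => SIG Y : hU, hTypesData f X Y) hUnit
        (hPair hU (fun Y => hTypesData f hUnit Y) hBool
          (hPair hUnit (fun x => SIG y : hBool, hPointsData f hUnit hBool x y) hStar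
            (hPair hBool (fun y => hPointsData f hUnit hBool hStar y) hFalse
              (hPairND (hNeg (hId hBool (f @ hUnit @ hStar) (f @ hBool @ hFalse)))
                 (hProd (hIsProp (hId hUnit hStar hStar))
                        (hIsProp (hId hBool hFalse hFalse)))
                 (hCenterFamilySeparates w)
                 (hPairND (hIsProp (hId hUnit hStar hStar))
                          (hIsProp (hId hBool hFalse hFalse))
                          hUnitLoopsProp hFalseLoopsProp))))))).

(** * Gluing two pointed types *)

(** Induction on [p] turns [q] into a loop at [x], to which [k] applies. *)
Definition hPathsProp (X x k z : hterm) : hterm :=
  \p : hId X x z, \q : hId X x z,
  hJ X x (fun z p => PI q : hId X x z, hId (hId X x z) p q)
    (\q : hId X x x, k @ hRefl X x @ q) z p @ q.

Section Glue.

Variables X Y x y P Q : hterm.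

Definition hToX (u : hterm) := P ~> hId X x u.
Definition hToY (v : hterm) := Q ~> hId Y y v.
Definition hWitness (u v : hterm) := hTrunc (hProd (hToX u) (hToY v)).
Definition hFiber (u : hterm) := SIG v : Y, hWitness u v.
Definition hGlue := SIG u : X, hFiber u.

Definition hMkWitness (u v p q : hterm) :=
  hTrIn (hProd (hToX u) (hToY v)) (hPairND (hToX u) (hToY v) p q).

Definition hMk (u v t : hterm) :=
  hPair X hFiber u (hPair Y (hWitness u) v t).

Definition hBase :=
  hMk x y (hMkWitness x y (\_ : P, hRefl X x) (\_ : Q, hRefl Y y)).

Definition hProjX := \z : hGlue, hFst X hFiber z.

Definition hProjY :=
  \z : hGlue, hFst Y (hWitness (hFst X hFiber z)) (hSnd X hFiber z).

Definition hMkIsEquiv (B e g gK hK : hterm) :=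
  let L := SIG g : B ~> hGlue, PI z : hGlue, hId hGlue (g @ (e @ z)) z in
  let R := SIG h : B ~> hGlue, PI b : B, hId B (e @ (h @ b)) b in
  hPairND L R
    (hPair (B ~> hGlue) (fun g => PI z : hGlue, hId hGlue (g @ (e @ z)) z) g gK)
    (hPair (B ~> hGlue) (fun h => PI b : B, hId B (e @ (h @ b)) b) g hK).

(** Conversion has no eta for sums, so equations on the glued type are proved on triples. *)
Definition hGlueInd (C : hterm -> hterm) (c : hterm -> hterm -> hterm -> hterm) :=
  \z : hGlue,
  hSplit X hFiber C
    (fun u z => hSplit Y (hWitness u) (fun z => C (hPair X hFiber u z)) (c u) z) z.

Definition hSquash (u v s t : hterm) :=
  hJ (hWitness u v) s (fun t _ => hId hGlue (hMk u v s) (hMk u v t))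
    (hRefl hGlue (hMk u v s)) t (hTrSquash (hProd (hToX u) (hToY v)) s t).

(** With [P] refuted by [n], [u] is unconstrained; with [q] in [Q], [v] is tied to [y]. The inverse
    therefore sends [u] to the triple over [u] and [y], and one composite is the identity by
    computation. *)
Definition hEquivX (n q ky : hterm) :=
  let s u := hMkWitness u y
               (\p : P, hEmptyElim (hId X x u) (n @ p)) (\_ : Q, hRefl Y y) in
  let g := \u : X, hMk u y (s u) in
  hMkIsEquiv X hProjX g
    (hGlueInd (fun z => hId hGlue (g @ (hProjX @ z)) z) (fun u v t =>
       (* The type of [t] mentions [v], so [t] is quantified anew during the induction on the path
          from [y] to [v]; two witnesses over the same [u] and [y] then agree by [hSquash]. *)
       hJ Y y (fun v _ => PI t : hWitness u v, hId hGlue (hMk u y (s u)) (hMk u v t))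
         (\t : hWitness u y, hSquash u y (s u) t) v
         (hTrElim (hProd (hToX u) (hToY v)) (hId Y y v) (hPathsProp Y y ky v)
            (\c : hProd (hToX u) (hToY v), hSnd (hToX u) (fun _ => hToY v) c @ q) t)
       @ t))
    (\u : X, hRefl X u).

Definition hEquivY (n p kx : hterm) :=
  let s v := hMkWitness x v
               (\_ : P, hRefl X x) (\q : Q, hEmptyElim (hId Y y v) (n @ q)) in
  let g := \v : Y, hMk x v (s v) in
  hMkIsEquiv Y hProjY g
    (hGlueInd (fun z => hId hGlue (g @ (hProjY @ z)) z) (fun u v t =>
       hJ X x (fun u _ => PI t : hWitness u v, hId hGlue (hMk x v (s v)) (hMk u v t))
         (\t : hWitness x v, hSquash x v (s v) t) u
         (hTrElim (hProd (hToX u) (hToY v)) (hId X x u) (hPathsProp X x kx u)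
            (\c : hProd (hToX u) (hToY v), hFst (hToX u) (fun _ => hToY v) c @ p) t)
       @ t))
    (\v : Y, hRefl Y v).

End Glue.

(** * From a separating family to weak excluded middle *)

Definition hBoolDec (b c : hterm) : hterm :=
  let D b c := hSum (hId hBool b c) (hNeg (hId hBool b c)) in
  let same b := hInl (hId hBool b b) (hNeg (hId hBool b b)) (hRefl hBool b) in
  hBoolElim (fun b => D b c)
    (hBoolElim (fun c => D hFalse c)
       (same hFalse)
       (hInr (hId hBool hFalse hTrue) (hNeg (hId hBool hFalse hTrue))
          (\p : hId hBool hFalse hTrue, hTrueNeFalse (hSym hBool hFalse hTrue p)))
       c)
    (hBoolElim (fun c => D hTrue c)
       (hInr (hId hBool hTrue hFalse) (hNeg (hId hBool hTrue hFalse))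
          (\p : hId hBool hTrue hFalse, hTrueNeFalse p))
       (same hTrue)
       c)
    b.

(** If [fx = fz], an element of [A] yields [NN], hence [fy = fz] and [fx = fy], against [n].
    Otherwise an element of [N] would yield [fx = fz]. *)
Definition hDecide (f i X Y x y n kx ky : hterm) : hterm :=
  \A : hU,
  let N := hNeg A in
  let NN := hNeg N in
  let Z := hGlue X Y x y NN N in
  let z := hBase X Y x y NN N in
  let fx := f @ X @ x in
  let fy := f @ Y @ y in
  let fz := f @ Z @ z in
  (* The projections of [z] compute to [x] and [y], so invariance equates [fx] or [fy] with [fz]
     directly. *)
  let onX a := i @ Z @ X @ hProjX X Y x y NN N
                 @ hEquivX X Y x y NN N (\m : NN, m @ a) a ky @ z in
  (* Here [a : NN] is used twice: [NN] is both the type [P] and the negation of the type [Q]. *)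
  let onY a := i @ Z @ Y @ hProjY X Y x y NN N
                 @ hEquivY X Y x y NN N a a kx @ z in
  let E := hId hBool fx fz in
  hCase E (hNeg E) (fun _ => hSum N NN)
    (\p : E, hInl N NN (\a : A,
       n @ hTrans hBool fx fz fy p (hSym hBool fy fz (onY (\m : N, m @ a)))))
    (\p : hNeg E, hInr N NN (\m : N, p @ onX m))
    (hBoolDec fx fz).

Definition hWEMOfSep : hterm :=
  \s : hSep,
  hSplit hBoolFamily hFamilyData (fun _ => hWEM) (fun f s =>
  hSplit (hInvariant f) (fun _ => hSeparation f) (fun _ => hWEM) (fun i s =>
  hSplit hU (fun X => SIG Y : hU, hTypesData f X Y) (fun _ => hWEM) (fun X s =>
  hSplit hU (fun Y => hTypesData f X Y) (fun _ => hWEM) (fun Y s =>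
  hSplit X (fun x => SIG y : Y, hPointsData f X Y x y) (fun _ => hWEM) (fun x s =>
  hSplit Y (fun y => hPointsData f X Y x y) (fun _ => hWEM) (fun y s =>
  hSplit (hNeg (hId hBool (f @ X @ x) (f @ Y @ y)))
    (fun _ => hProd (hIsProp (hId X x x)) (hIsProp (hId Y y y))) (fun _ => hWEM)
    (fun n k =>
  hDecide f i X Y x y n
    (hFst (hIsProp (hId X x x)) (fun _ => hIsProp (hId Y y y)) k)
    (hSnd (hIsProp (hId X x x)) (fun _ => hIsProp (hId Y y y)) k))
  s) s) s) s) s) s) s.

Definition hEquivalence : hterm :=
  hPairND (hArr hWEM hSep) (hArr hSep hWEM) hSepOfWEM hWEMOfSep.

Theorem theorem2p9 :
  exists t : tm, [] |-- t : tIff tWEM tSeparatingInvariantFamily.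
Proof.
  exists (hEquivalence 0).
  (* Soundness holds for every amount of fuel; 200 is merely enough for the check to succeed. *)
  apply (check_sound 200 (infer 200) (infer_sound 200)); [constructor |].
  vm_compute. reflexivity.
Qed.
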